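(* Let $m\ge 0$ and let $G$ be a $2$-connected graph on $3m+2$ vertices with no cycle of length congruent to $0$ or $1$ modulo $3$. Then (1) $i(G)=m+1$; (2) no minimum independent dominating set of $G$ contains an admissible pair; (3) $i(G-x)\ge i(G)$ for every $x\in V(G)$. Moreover, for every $x\in V(G)$ there is a minimum independent dominating set of $G$ containing $x$.
   Context: Graphs are finite and simple; here a graph is $2$-connected if it is $K_2$, or it has at least $3$ vertices and no vertex whose removal disconnects it. A graph is called $(0,1)$-ternary if it has no cycle of length (number of edges) congruent to $0$ or $1$ modulo $3$. $i(G)$ is the minimum size of an independent dominating set (an independent set $A$ such that every vertex is in $A$ or adjacent to a vertex of $A$). For a $2$-connected $(0,1)$-ternary graph $G$, a pair $\{u,v\}\subseteq V(G)$ is admissible if one can obtain a $2$-connected $(0,1)$-ternary graph from $G$ by attaching an ear (a path with new internal vertices) whose endpoints are exactly $u$ and $v$. *)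

(* Defs.v *)
From mathcomp Require Import all_boot.

Set Implicit Arguments.
Unset Strict Implicit.
Unset Printing Implicit Defensive.

Record sgraph := SGraph {
  vertex :> finType;
  adj : rel vertex;
  adj_sym : symmetric adj;
  adj_irr : irreflexive adj
}.
Arguments adj {s}.

Section DelVertex.
Variables (G : sgraph) (x : G).

Definition del_adj : rel {y : G | y != x} := fun y z => adj (val y) (val z).

Lemma del_adj_sym : symmetric del_adj.
Proof. by move=> y z; apply: adj_sym. Qed.

Lemma del_adj_irr : irreflexive del_adj.
Proof. by move=> y; apply: adj_irr. Qed.

Definition del_vertex : sgraph := SGraph del_adj_sym del_adj_irr.

End DelVertex.

Definition connected (G : sgraph) : Prop := forall x y : G, connect adj x y.

Definition is_K2 (G : sgraph) : Prop :=
  #|G| = 2 /\ forall x y : G, x != y -> adj x y.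

Definition two_connected (G : sgraph) : Prop :=
  is_K2 G \/
  [/\ 2 < #|G|, connected G & forall x : G, connected (del_vertex x)].

(* The bound on the size matters: [ucycle] also accepts the empty sequence and
   the sequence of the two ends of an edge. *)
Definition is_cycle (G : sgraph) (c : seq G) : Prop :=
  ucycle adj c /\ 2 < size c.

Definition ternary01 (G : sgraph) : Prop :=
  ~ exists2 c : seq G, is_cycle c &
      size c = 0 %[mod 3] \/ size c = 1 %[mod 3].

Section AddEar.
Variables (G : sgraph) (u v : G) (k : nat).

(* The ear is the path u, 0, 1, ..., k-1, v, whose k internal vertices are the
   elements of ['I_k]; for k = 0 it is the single edge uv. The relation below
   contains each edge of the ear in one direction. *)
Definition ear_arc (a b : G + 'I_k) : bool :=
  match a, b with
  | inl x, inl y => [&& k == 0, x == u & y == v]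
  | inl x, inr i => (x == u) && (i == 0 :> nat)
  | inr i, inr j => j == i.+1 :> nat
  | inr i, inl y => (i.+1 == k) && (y == v)
  end.

Definition old_adj (a b : G + 'I_k) : bool :=
  match a, b with inl x, inl y => adj x y | _, _ => false end.

Definition ear_adj : rel (G + 'I_k)%type :=
  fun a b => [|| old_adj a b, ear_arc a b | ear_arc b a].

Lemma ear_adj_sym : symmetric ear_adj.
Proof.
move=> a b; rewrite /ear_adj (orbC (ear_arc a b)); congr (_ || _).
by case: a b => [x|i] [y|j] //=; apply: adj_sym.
Qed.

Lemma ear_adj_irr : u != v -> irreflexive ear_adj.
Proof.
move=> uv [x|i]; rewrite /ear_adj orbb /=; last by rewrite (ltn_eqF (ltnSn i)).
rewrite adj_irr /=; apply/negP => /and3P[_ /eqP xu /eqP xv].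
by move: uv; rewrite -xu -xv eqxx.
Qed.

Definition add_ear (uv : u != v) : sgraph :=
  SGraph ear_adj_sym (ear_adj_irr uv).

End AddEar.

(* An ear without internal vertices must be a new edge. *)
Definition admissible (G : sgraph) (u v : G) : Prop :=
  exists (uv : u != v) (k : nat),
    [/\ k = 0 -> ~~ adj u v,
        two_connected (add_ear k uv) & ternary01 (add_ear k uv)].

Definition independent (G : sgraph) (A : {set G}) : bool :=
  [forall x in A, forall y in A, ~~ adj x y].

Definition dominating (G : sgraph) (A : {set G}) : bool :=
  [forall x, (x \in A) || [exists y in A, adj x y]].

Definition indep_dom (G : sgraph) (A : {set G}) : bool :=
  independent A && dominating A.

Lemma indep_dom_exists (G : sgraph) :
  exists k, [exists A : {set G}, indep_dom A && (#|A| == k)].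
Proof.
have ind0 : independent (set0 : {set G}).
  by apply/forall_inP => x; rewrite inE.
have [A /maxsetP[indA maxA] _] := @maxset_exists G (@independent G) set0 ind0.
exists #|A|; apply/existsP; exists A; rewrite eqxx andbT /indep_dom indA /=.
apply/forallP => x; have [//|xA] := boolP (x \in A) => /=.
apply: contraNT xA; rewrite negb_exists_in => /forall_inP nadj.
suff indxA : independent (x |: A) by rewrite -(maxA _ indxA (subsetUr _ _)) setU11.
apply/forall_inP => y /setU1P[-> | yA]; apply/forall_inP => z /setU1P[-> | zA].
- by rewrite adj_irr.
- exact: nadj.
- by rewrite adj_sym; apply: nadj.
- by move/forall_inP: indA => /(_ y yA)/forall_inP; apply.
Qed.

Definition idom (G : sgraph) : nat := ex_minn (indep_dom_exists G).

Definition min_indep_dom (G : sgraph) (A : {set G}) : bool :=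
  indep_dom A && (#|A| == idom G).

(* Main.v *)
Require Import Defs.
From mathcomp Require Import all_boot zify.

(** Fix two vertices u, v that are adjacent or form an admissible
    pair. All simple u-v paths have the same length modulo 3, so no subdivided
    K4 can occur in G together with the (possibly virtual) edge uv: its four
    triangles and three quadrangles would force the number of edges of the
    subdivision to be both 1 and 0 modulo 3. Hence G is a series-parallel network
    between u and v in which all pieces put in parallel have 3k inner vertices.

    For an independent set A leaving at most one inner vertex undominated, an
    induction along this decomposition gives
      |I| + d(u) + d(v) <= 3 |A /\ I| + (number of undominated inner vertices)
                             + [u in A] + [v in A],
    where I is the set of inner vertices and d tells whether a terminal has a
    neighbour in A. Taking for u, v an edge at x yields the bounds on i(G) and
    i(G - x); taking an admissible pair contained in A yields |A| >= m + 2.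
    Conversely, giving u the level 0 and counting steps modulo 3 along all paths
    from u to v, the vertices of level 0 form an independent dominating set with
    m + 1 elements that contains u. *)

Set Implicit Arguments.
Unset Strict Implicit.
Unset Printing Implicit Defensive.

(** * Paths *)

Section Paths.
Variable T : finType.
Implicit Types (e : rel T) (x y z : T) (s t p : seq T) (W K : {set T}).

Lemma path_split e x s y t :
  path e x (s ++ y :: t) = path e x (rcons s y) && path e y t.
Proof. by rewrite -cat_rcons cat_path last_rcons. Qed.

Lemma path_rcons_rev e x s y :
  symmetric e -> path e x (rcons s y) -> path e y (rcons (rev s) x).
Proof.
move=> sym; rewrite (eq_path (e' := fun a b => e b a)) => [|a b]; last exact: sym.
by rewrite -rev_path last_rcons belast_rcons rev_cons.
Qed.

Lemma count_uniq s : (forall x, count_mem x s <= 1) -> uniq s.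
Proof.
move=> le1; apply: count_mem_uniq => x; have := le1 x.
by rewrite -has_pred1 has_count; case: (count_mem x s) => [|[]].
Qed.

(** Rerouted paths rearrange pieces of one repetition-free list, so their simplicity reduces to
    inequalities between multiplicities, which [solve_count] hands to linear arithmetic. *)
Lemma uniq_count s t :
  uniq t -> (forall x, count_mem x s <= count_mem x t) -> uniq s.
Proof.
move=> Ut le; apply: count_uniq => x.
by apply: leq_trans (le x) _; rewrite count_uniq_mem // leq_b1.
Qed.

End Paths.

Ltac solve_count :=
  rewrite /= !(count_cat, count_rev) /= ?(count_cat, count_rev) /=
    ?(count_cat, count_rev) /= ?(count_cat, count_rev) /= ?(count_cat, count_rev) /=;
  repeat match goal with
  | |- context [nat_of_bool ?b] => generalize (nat_of_bool b); intro
  | |- context [count ?p ?s] => generalize (count p s); intro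
  end; clear; lia.
Ltac solve_uniq U := apply: (uniq_count U) => ?; solve_count.

(** * Restricted walks, detours and forbidden subdivisions of K4 *)

Section Networks.
Variable T : finType.
Implicit Types (e : rel T) (u v w x y z : T) (s p : seq T) (I K W : {set T}).

Lemma path_shorten e x s y : x != y -> path e x (rcons s y) ->
  exists t, [/\ path e x (rcons t y), uniq (x :: rcons t y) &
    {subset t <= s}].
Proof.
move=> xy es; have Ey : last x (rcons s y) = y by rewrite last_rcons.
case: (shortenP es) Ey => p ep Up sub Ey.
case/lastP: p ep Up sub Ey => [|t z] ep Up sub /=; first by move=> E; rewrite E eqxx in xy.
rewrite last_rcons => E; subst z; exists t; split=> // z zt.
have : z \in rcons s y by apply: sub; rewrite mem_rcons inE zt orbT.
rewrite mem_rcons inE => /predU1P[E|//]; subst z.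
by move: Up; rewrite /= rcons_uniq zt andbF.
Qed.

Lemma subpath_between e (X Y : pred T) x p :
  path e x p -> X x -> Y (last x p) -> (forall z, X z -> ~~ Y z) ->
  exists a s b, [/\ X a, Y b, path e a (rcons s b), uniq (a :: rcons s b) &
    forall z, z \in s -> ~~ X z /\ ~~ Y z].
Proof.
move=> ep Xx Yl dXY.
suff [a [s [b [Xa Yb es ns]]]] : exists a s b, [/\ X a, Y b, path e a (rcons s b) &
    forall z, z \in s -> ~~ X z /\ ~~ Y z].
  have ab : a != b by apply: contraTneq Yb => <-; exact: dXY.
  have [t [et Ut sub]] := path_shorten ab es.
  by exists a, t, b; split=> // z /sub/ns.
(* In the first alternative [x] need not satisfy [X], so that the segment can grow backwards until
   it meets [X]. *)
suff [[s [b [Yb es ns]]]|[a [s [b H]]]|Yx] : [\/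
   exists s b, [/\ Y b, path e x (rcons s b) & forall z, z \in s -> ~~ X z /\ ~~ Y z],
   exists a s b, [/\ X a, Y b, path e a (rcons s b) &
    forall z, z \in s -> ~~ X z /\ ~~ Y z] | Y x].
- by exists x, s, b.
- by exists a, s, b.
- by rewrite (negPf (dXY _ Xx)) in Yx.
elim: p x ep Yl {Xx} => [|y p IH] x /=; first by move=> _ Yx; constructor 3.
case/andP=> exy ep Yl; case Yy: (Y y).
  by constructor 1; exists [::], y; rewrite /= exy.
case: (IH y ep Yl) => [[s [b [Yb es ns]]]|H|]; last by rewrite Yy.
- case Xy: (X y); first by constructor 2; exists y, s, b.
  constructor 1; exists (y :: s), b; split=> //=; first by rewrite exy.
  by move=> z /predU1P[->|/ns //]; rewrite Xy Yy.
- by constructor 2.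
Qed.

Definition avoid e W : rel T := [rel x y | [&& e x y, x \notin W & y \notin W]].
(** Edges with both ends outside [K] are dropped: when [K] holds the inner vertices of a parallel
    piece, an edge joining the terminals stays outside that piece. *)
Definition touch e K : rel T := [rel x y | e x y && ((x \in K) || (y \in K))].

Lemma avoid_sub e W : subrel (avoid e W) e.
Proof. by move=> x y /and3P[]. Qed.

Lemma touch_sub e K : subrel (touch e K) e.
Proof. by move=> x y /andP[]. Qed.

Lemma avoid_sym e W : symmetric e -> symmetric (avoid e W).
Proof. by move=> sym x y; rewrite /avoid /= sym (andbC (x \notin W)). Qed.

Lemma touch_sym e K : symmetric e -> symmetric (touch e K).
Proof. by move=> sym x y; rewrite /touch /= sym orbC. Qed.

Lemma path_avoid_notin e W x p : path (avoid e W) x p -> forall z, z \in p -> z \notin W.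
Proof.
elim: p x => //= y p IH x /andP[/and3P[_ _ yW] ep] z.
by case/predU1P=> [->|/(IH _ ep)].
Qed.

(** Cut the walk at its first vertex outside [K]: up to there every edge touches [K], and by closure
    that vertex is in [W]. The pieces of a decomposition inherit reachability this way. *)
Lemma walk_region (f : rel T) K W x (t : T) :
  (forall a b, f a b -> a \in K -> b \in K :|: W) ->
  x \in K -> connect f x t ->
  connect (touch f K) x t \/
  exists w z, [/\ w \in W, connect (touch f K) x w, f z w & z \in K].
Proof.
move=> clo xK /connectP[p ep ->] {t}.
elim: p x xK ep => [|y p IH] x xK /=; first by left.
case/andP=> fxy ep; have := clo _ _ fxy xK; rewrite inE.
have c1 : connect (touch f K) x y by apply: connect1; rewrite /touch /= fxy xK.
case/orP=> [yK|yW]; last by right; exists y, x.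
case: (IH y yK ep) => [c|[w [z [wW c fz zK]]]].
  by left; apply: connect_trans c1 c.
by right; exists w, z; split=> //; apply: connect_trans c1 c.
Qed.

(* The four branch vertices [u, i, j, l] and the six paths between them form a
   subdivided K4, where the path from [l] to [u] runs through [v] and a virtual
   edge [uv]. *)
Lemma no_crossing_detours e u v r i j l A B C D S R : symmetric e ->
  (forall x s, path e x (rcons s x) -> uniq (x :: s) -> 1 < size s ->
     size s = 1 %[mod 3]) ->
  (forall p, path e u p -> uniq (u :: p) -> last u p = v ->
     size p = r %[mod 3]) ->
  path e u (A ++ i :: B ++ j :: C ++ l :: D) -> last l D = v ->
  path e u (rcons S j) -> path e i (rcons R l) ->
  uniq (u :: A ++ i :: B ++ j :: C ++ l :: D ++ S ++ R) -> False.
Proof.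
move=> sym cyc pth; rewrite !path_split => /and4P[eA eB eC eD] lD eS eR U.
have [eA' eB'] := (path_rcons_rev sym eA, path_rcons_rev sym eB).
have [eS' eR'] := (path_rcons_rev sym eS, path_rcons_rev sym eR).
have Up q : path e u q -> last u q = v ->
    (forall x, count_mem x (u :: q) <=
      count_mem x (u :: A ++ i :: B ++ j :: C ++ l :: D ++ S ++ R)) ->
    size q = r %[mod 3].
  by move=> eq lq cq; exact: pth eq (uniq_count U cq) lq.
have Uc x q : path e x (rcons q x) -> 1 < size q ->
    (forall y, count_mem y (x :: q) <=
      count_mem y (u :: A ++ i :: B ++ j :: C ++ l :: D ++ S ++ R)) ->
    size q = 1 %[mod 3].
  by move=> eq lq cq; exact: cyc eq (uniq_count U cq) lq.
(* [H1] to [H4] are the two quadrangles and two triangles through the virtual edge; [H5] and [H6]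
   are the other triangles, [H7] the last quadrangle. *)
have H1 := Up (A ++ i :: B ++ j :: C ++ l :: D).
have H2 := Up (S ++ j :: C ++ l :: D).
have H3 := Up (A ++ i :: R ++ l :: D).
have H4 := Up (S ++ j :: rev B ++ i :: R ++ l :: D).
have H5 := Uc u (A ++ i :: B ++ j :: rev S).
have H6 := Uc i (B ++ j :: C ++ l :: rev R).
have H7 := Uc u (S ++ j :: C ++ l :: rev R ++ i :: rev A).
move: H1 H2 H3 H4 H5 H6 H7 {Up Uc U}.
rewrite !(rcons_cat, rcons_cons, path_split, last_cat, last_cons).
rewrite eA eB eC eD eS eR eA' eB' eS' eR' lD {eA eB eC eD eS eR eA' eB' eS' eR' lD cyc pth}.
rewrite !(size_cat, size_rev, size_rcons) /= !(size_cat, size_rev) /= ?(size_cat, size_rev) /= ?(size_cat, size_rev).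
move=> /(_ isT erefl) H1 /(_ isT erefl) H2 /(_ isT erefl) H3 /(_ isT erefl) H4.
move=> /(_ isT) H5 /(_ isT) H6 /(_ isT) H7.
have {}H1 := H1 (fun x => ltac:(solve_count)).
have {}H2 := H2 (fun x => ltac:(solve_count)).
have {}H3 := H3 (fun x => ltac:(solve_count)).
have {}H4 := H4 (fun x => ltac:(solve_count)).
have {}H5 := H5 ltac:(clear; lia) (fun x => ltac:(solve_count)).
have {}H6 := H6 ltac:(clear; lia) (fun x => ltac:(solve_count)).
have {}H7 := H7 ltac:(clear; lia) (fun x => ltac:(solve_count)).

(* Each of the six branch paths lies on two triangles and two quadrangles. With length [2 - r] for
   the virtual edge every cycle has length 2 modulo 3, so twice the total length is 8 by the
   triangles and 6 by the quadrangles. *)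
lia.
Qed.

Lemma connect_closed e K x y :
  (forall a b, e a b -> a \in K -> b \in K) -> x \in K -> connect e x y -> y \in K.
Proof.
move=> clo xK /connectP[p ep ->] {y}.
by elim: p x xK ep => //= y p IH x xK /andP[/clo/(_ xK) yK]; apply: IH.
Qed.

Lemma connect_edge e x y : x != y -> connect e x y -> exists z, e z y.
Proof.
move=> xy /connectP[p ep Ey]; case/lastP: p ep Ey => [|p z]; first by move=> _ E; rewrite E eqxx in xy.
by rewrite rcons_path last_rcons => /andP[_ ez] ->; exists (last x p).
Qed.

Lemma connect_mono (e e' : rel T) : subrel e e' -> subrel (connect e) (connect e').
Proof. by move=> ee'; apply: connect_sub => x y /ee'; apply: connect1. Qed.

Lemma touch_avoid e K W :
  subrel (touch (avoid e W) K) (avoid (touch e K) W).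
Proof. by move=> x y /andP[/and3P[exy xW yW] xy]; rewrite /avoid /touch /= exy xW yW xy. Qed.

(** * Series-parallel decomposition *)

(* [e], with inner vertices [I], becomes 2-connected and free of cycles of length
   0 or 1 modulo 3 once its terminals [u] and [v] are joined by a new path of
   length [2 - r] modulo 3. *)
Record linked e u v I (r : nat) : Prop := Linked {
  linked_sym : symmetric e;
  linked_irr : irreflexive e;
  linked_supp : forall x y, e x y -> x \in u |: (v |: I);
  linked_neq : u != v;
  linked_notin1 : u \notin I;
  linked_notin2 : v \notin I;
  linked_connect : connect e u v;
  linked_avoid : forall z w, z \in I -> z != w ->
    exists t : T, [/\ t \in [set u; v], t != w & connect (avoid e [set w]) z t];
  linked_cycle : forall x s, path e x (rcons s x) -> uniq (x :: s) ->
    1 < size s -> size s = 1 %[mod 3];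
  linked_path : forall p, path e u p -> uniq (u :: p) -> last u p = v ->
    size p = r %[mod 3]
}.

Lemma linkedC e u v I r : linked e u v I r -> linked e v u I r.
Proof.
case=> sym irr supp uv uI vI c av cyc pth; split=> //.
- by move=> x y /supp; rewrite !inE; case: (x == u); rewrite ?orbT.
- by rewrite eq_sym.
- by rewrite (sym_connect_sym sym).
- by move=> z w zI zw; have := av z w zI zw; rewrite setUC.
- move=> p ep Up lp.
  have ep' : path e u (rev (belast v p)).
    by rewrite -lp rev_path (eq_path (e' := e)) // => a b; apply: sym.
  have Ep : u :: rev (belast v p) = rev (v :: p).
    by rewrite -lp -rev_rcons -lastI.
  rewrite -(pth _ ep') ?size_rev ?size_belast //.
    by rewrite Ep rev_uniq.
  by rewrite -[last _ _]/(last u (u :: rev (belast v p))) Ep rev_cons last_rcons.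
Qed.

(* The detour from [u] to [j] along [S] is pushed towards [v]: either the vertex
   [j] separates [u] from [v], or some detour around [j] leads further; it cannot
   start strictly between [u] and [j] without meeting [S], by [no_crossing_detours]. *)
Lemma extend_detour e u v I r j p1 p2 S : linked e u v I r ->
  path e u (p1 ++ j :: p2) -> last j p2 = v ->
  uniq (u :: p1 ++ j :: p2 ++ S) -> path e u (rcons S j) ->
  (exists w, [/\ w != u, w != v & ~~ connect (avoid e [set w]) u v]) \/
  (exists P Q, [/\ path e u (rcons P v), path e u (rcons Q v) &
     uniq (u :: v :: P ++ Q)]).
Proof.
move=> lk; have [n le_n] := ubnP (size p2).
elim: n p2 le_n p1 j S => // n IH p2 le_n p1 j S ep lp U eS.
have [E|p2n] := eqVneq p2 [::].
  move: ep; rewrite E path_split => /andP[ep1 _]; rewrite E /= in lp.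
  right; exists p1, S; rewrite -lp; split; [by [] | by [] |].
  by rewrite E in U; solve_uniq U.
have vp2 : v \in p2 by case: (p2) p2n lp => //= a q _ <-; apply: mem_last.
have ju : j != u.
  by apply: contraTneq U => ->; rewrite /= mem_cat inE eqxx orbT.
have jv : j != v.
  apply: contraTneq vp2 => <-.
  have : uniq (j :: p2) by solve_uniq U.
  by case/andP.
case: (boolP (connect (avoid e [set j]) u v)) => [|nc]; last by left; exists j.
case/connectP=> q eq lq.
(* A u-v path avoiding [j] jumps over it: the segment [s] leaves the chosen path at [a] before [j],
   returns at [b] after [j], and is otherwise off that path. *)
have [|||a [s [b [Xa Yb es Us ns]]]] := @subpath_between _ (mem (u :: p1)) (mem p2) _ _ eq.
- exact: mem_head.
- by rewrite -lq.
- move=> z zu; apply/negP => zp2.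
  have : uniq ((u :: p1) ++ p2) by solve_uniq U.
  by rewrite cat_uniq => /and3P[_ /hasPn/(_ z zp2)/negP[]].
have jbs : j \notin rcons s b.
  by apply/negP => /(path_avoid_notin es); rewrite inE eqxx.
have {}es := sub_path (@avoid_sub e [set j]) es.
move: Yb => /= /splitPr Eb; case: Eb ep lp U vp2 le_n ns {p2n} => C D ep lp U vp2 le_n ns.
have ub : u != b.
  by apply: contraTneq U => ->; rewrite /= !(mem_cat, inE) eqxx !orbT.
(* A route from [u] to [b] inside [S] and [s] is a detour landing beyond [j]; the part [D] still
   ahead is shorter, so the induction applies. *)
have next s0 : path e u (rcons s0 b) -> {subset s0 <= S ++ s} ->
    (exists w, [/\ w != u, w != v & ~~ connect (avoid e [set w]) u v]) \/
    (exists P Q, [/\ path e u (rcons P v), path e u (rcons Q v) &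
     uniq (u :: v :: P ++ Q)]).
  move=> es0 ss0; have [t [et Ut st]] := path_shorten ub es0.
  apply: (IH D _ (p1 ++ j :: C) b t) => //.
  - by move: le_n; rewrite size_cat /=; clear; lia.
  - by rewrite -catA.
  - by move: lp; rewrite last_cat.
  have UP : uniq (u :: p1 ++ j :: C ++ b :: D) by solve_uniq U.
  suff Ut' : uniq ((u :: p1 ++ j :: C ++ b :: D) ++ t) by solve_uniq Ut'.
  rewrite cat_uniq UP /=; apply/andP; split; last first.
    by move: Ut; rewrite /= rcons_uniq => /and3P[].
  apply/hasPn => z /st/ss0; rewrite mem_cat => /orP[zS|zs].
    have U1 : uniq ((u :: p1 ++ j :: C ++ b :: D) ++ S) by solve_uniq U.
    by move: U1; rewrite cat_uniq => /and3P[_ /hasPn/(_ z zS)].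
  have := ns z zs; rewrite /= !(mem_cat, inE) !negb_or.
  have zj : z != j.
    by apply: contraNneq jbs => <-; rewrite mem_rcons inE zs orbT.
  by case=> /andP[-> ->] /andP[-> /andP[-> ->]]; rewrite zj.
(* If [s] meets [S] at [z], follow [S] from [u] to [z] and then [s] to [b]. *)
case: (boolP (has (mem S) s)) => [/hasP[z zs /= zS]|nS].
  move/splitPr: zs => Es; case: Es es next => s1 s2 es next.
  move/splitPr: zS => ES; case: ES eS next => S1 S2 eS next.
  apply: (next (S1 ++ z :: s2)).
    rewrite rcons_cat rcons_cons path_split; move: es eS; rewrite !rcons_cat !rcons_cons !path_split.
    by case/andP=> _ -> /andP[->].
  by move=> y; rewrite !(mem_cat, inE); case/or3P=> ->; rewrite ?orbT.
have [Ea|au] := eqVneq a u.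
  by apply: (next s); [rewrite -Ea | move=> y; rewrite mem_cat orbC => ->].
move: Xa; rewrite /= inE (negPf au) /= => /splitPr Ea.
(* Now [a] lies strictly between [u] and [j], and the detours [S] and [s] are disjoint and cross. *)
case: Ea ep U ns {next IH} => A B ep U ns; exfalso.
have Rs : uniq s by move: Us; rewrite /= rcons_uniq => /and3P[].
have U' : uniq ((u :: (A ++ a :: B) ++ j :: (C ++ b :: D) ++ S) ++ s).
  rewrite cat_uniq U Rs andbT /=; apply/hasPn => z zs.
  have := ns z zs; move/hasPn: nS => /(_ z zs) /=.
  have zj : z != j.
    by apply: contraNneq jbs => <-; rewrite mem_rcons inE zs orbT.
  rewrite !(mem_cat, inE) !negb_or zj => -> [/andP[-> /andP[-> /andP[-> ->]]]].
  by case/andP=> -> /andP[-> ->].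
apply: (@no_crossing_detours e u v r a j b A B C D S s) => //.
- exact: linked_sym lk.
- exact: linked_cycle lk.
- exact: linked_path lk.
- by move: ep; rewrite -catA.
- by move: lp; rewrite last_cat.
- solve_uniq U'.
Qed.

Lemma two_paths e u v I r : linked e u v I r -> ~~ e u v ->
  (exists w, [/\ w != u, w != v & ~~ connect (avoid e [set w]) u v]) \/
  (exists P Q, [/\ path e u (rcons P v), path e u (rcons Q v) &
     uniq (u :: v :: P ++ Q)]).
Proof.
move=> lk nuv; case/connectP: (linked_connect lk) => p0 ep0.
case: (shortenP ep0) => [[|j p]] ep Up _ lp.
  by have := linked_neq lk; rewrite lp eqxx.
(* The first edge of the path is also the first detour, hence the two empty sequences. *)
apply: (@extend_detour _ _ _ _ _ j [::] p [::] lk) => //=.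
- by rewrite cats0.
- by move: ep => /= /andP[->].
Qed.

(* Series-parallel networks: edge relation, two terminals, inner vertices. *)
Inductive net : rel T -> T -> T -> {set T} -> Prop :=
| net_edge (e : rel T) u v : u != v ->
    (forall x y, e x y = (x == u) && (y == v) || (x == v) && (y == u)) ->
    net e u v set0
| net_series (e1 e2 e : rel T) u w v (I1 I2 : {set T}) :
    net e1 u w I1 -> net e2 w v I2 ->
    (forall x y, e x y = e1 x y || e2 x y) ->
    [disjoint u |: I1 & v |: I2] ->
    net e u v (w |: (I1 :|: I2))
| net_parallel (e1 e2 e : rel T) u v (I1 I2 : {set T}) :
    net e1 u v I1 -> net e2 u v I2 ->
    (forall x y, e x y = e1 x y || e2 x y) ->
    [disjoint I1 & I2] -> 3 %| #|I1| -> 3 %| #|I2| ->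
    net e u v (I1 :|: I2).

(** Walks leave [K] only through [u] or [v], so vertices of [K] keep their access to the terminals.
    Cycles and u-v paths of the piece are cycles and paths of [e], hence the same [r]. *)
Lemma linked_component e u v I K z0 r : linked e u v I r ->
  K \subset I -> (forall a b, e a b -> a \in K -> b \in K :|: [set u; v]) ->
  z0 \in K -> linked (touch e K) u v K r.
Proof.
move=> lk KI clo z0K.
have [sym irr supp uv uI vI c av cyc pth] := lk.
have av' z w : z \in K -> z != w ->
    exists t : T, [/\ t \in [set u; v], t != w & connect (avoid (touch e K) [set w]) z t].
  move=> zK zw; have [t [tuv tw ct]] := av z w (subsetP KI _ zK) zw.
  have clo' a b : avoid e [set w] a b -> a \in K -> b \in K :|: [set u; v].
    by move/avoid_sub; apply: clo.
  have sub := connect_mono (@touch_avoid e K [set w]).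
  have [ct'|[t' [z' [t'uv ct' ft' _]]]] := walk_region clo' zK ct.
    by exists t; split=> //; apply: sub.
  exists t'; split=> //; last exact: sub.
  by case/and3P: ft' => _ _; rewrite inE.
have subK W := connect_mono (@avoid_sub (touch e K) W).
have zu : z0 != u by apply: contraTneq z0K => ->; apply: contraNN uI; apply: subsetP.
have zv : z0 != v by apply: contraTneq z0K => ->; apply: contraNN vI; apply: subsetP.
have symK := touch_sym K sym.
split=> //.
- by move=> x; rewrite /touch /= irr.
- move=> x y /andP[exy /orP[xK|yK]]; first by rewrite !inE xK !orbT.
  rewrite sym in exy; have := clo _ _ exy yK.
  by rewrite !inE => /orP[->|/orP[->|->]]; rewrite ?orbT.
- by apply: contraNN uI; apply: subsetP.
- by apply: contraNN vI; apply: subsetP.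
(* Avoiding [u], the vertex [z0] reaches [v]; avoiding [v], it reaches [u]. *)
- have [t [tuv tu ct]] := av' _ _ z0K zu; have [t' [t'uv t'v ct']] := av' _ _ z0K zv.
  move: tuv t'uv; rewrite !inE (negPf tu) (negPf t'v) orbF /= => /eqP Et /eqP Et'; subst t t'.
  apply: connect_trans (subK _ _ _ ct); rewrite (sym_connect_sym symK).
  exact: subK ct'.
- by move=> x s es; apply: cyc; apply: sub_path es; apply: touch_sub.
- by move=> p ep; apply: pth; apply: sub_path ep; apply: touch_sub.
Qed.

(** * Splitting at a vertex that separates the terminals *)

Section Cut.
Variables (e : rel T) (u v w : T) (I : {set T}) (r : nat).
Hypotheses (lk : linked e u v I r) (wu : w != u) (wv : w != v).
Hypothesis cut : ~~ connect (avoid e [set w]) u v.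
Let K := [set z | connect (avoid e [set w]) u z].

Lemma cut_notin : (w \notin K) * (v \notin K) * (u \in K).
Proof.
rewrite !inE cut connect0; split=> //; split=> //.
apply/negP => /connect_edge; rewrite eq_sym => /(_ wu)[z /and3P[_ _]].
by rewrite inE eqxx.
Qed.

Lemma cut_closed a b : e a b -> a \in K -> b \in K :|: [set w].
Proof.
move=> eab aK; rewrite !inE orbC; case: eqVneq => //= bw.
have aw : a != w by apply: contraTneq aK => ->; rewrite cut_notin.
rewrite inE in aK; apply: connect_trans aK (connect1 _).
by rewrite /avoid /= eab !inE aw.
Qed.

Lemma cut_subset : K :\ u \subset I.
Proof.
apply/subsetP => z /setD1P[zu zK].
have zv : z != v by apply: contraTneq zK => ->; rewrite cut_notin.
move: zK; rewrite inE => /connect_edge; rewrite eq_sym => /(_ zu)[y /avoid_sub].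
rewrite (linked_sym lk) => /(linked_supp lk).
by rewrite !inE (negPf zu) (negPf zv).
Qed.

Lemma cut_reach f : subrel f e -> forall a t, a \in K ->
  connect (touch f K) a t -> t \in K :|: [set w].
Proof.
move=> fe a t aK; apply: connect_closed; last by rewrite inE aK.
move=> x y /andP[/fe exy /orP[xK|yK]] _; last by rewrite inE yK.
exact: cut_closed exy xK.
Qed.

Lemma cut_connect : connect (touch e K) u w.
Proof.
have uK : u \in K by rewrite cut_notin.
case: (walk_region cut_closed uK (linked_connect lk)) => [|[t [z [+ c _ _]]]].
  move/(cut_reach (fun _ _ => id) uK).
  by rewrite !inE -in_set1 (negPf cut) inE eq_sym (negPf wv).
by rewrite inE => /eqP <-.
Qed.

(** Reversed, this path is the continuation [q] that [linked_cut] asks for when applied to the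
    opposite side. *)
Lemma cut_path : exists q, [/\ path (touch e K) u q, uniq (u :: q),
  last u q = w & {subset belast u q <= K}].
Proof.
have /connectP[p ep lp] := cut_connect.
case: (shortenP ep) lp => q eq Uq _ lq; exists q; split=> // z zq.
have : z \in K :|: [set w].
  apply: (cut_reach (fun _ _ => id)); last exact: (path_connect eq (mem_belast zq)).
  by rewrite cut_notin.
rewrite in_setU => /orP[//|]; rewrite in_set1 => /eqP Ez.
by move: Uq; rewrite lastI rcons_uniq -lq -Ez zq.
Qed.

(** Appending [q], which continues from [w] outside [K], turns every simple u-w path of the piece
    into a simple u-v path; this fixes its length modulo 3. Walks leave [K] only through [w], which
    takes over the role of [v]. *)
Lemma linked_cut q r1 : path e w q -> uniq (w :: q) -> last w q = v ->
  (forall z, z \in q -> z \notin K) -> r1 + size q = r %[mod 3] ->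
  linked (touch e K) u w (K :\ u) r1.
Proof.
move=> eq Uq lq qK Er.
have [sym irr supp uv uI vI c av cyc pth] := lk.
have [[wK vK] uK] := cut_notin.
have vKw : v \notin K :|: [set w] by rewrite in_setU (negPf vK) inE eq_sym.
split.
- exact: touch_sym.
- by move=> x; rewrite /touch /= irr.
- move=> x y /andP[exy xyK].
  suff: x \in K :|: [set w].
    by rewrite !(in_setU, in_set1, in_setD1) orbC; case: (x == u).
  case/orP: xyK => [xK|yK]; first by rewrite in_setU xK.
  by apply: cut_closed yK; rewrite sym.
- by rewrite eq_sym.
- by rewrite !inE eqxx.
- by rewrite in_setD1 (negPf wK) andbF.
- exact: cut_connect.
- move=> z w' /setD1P[zu zK] zw'.
  have [Ew|ww'] := eqVneq w' w.
    exists u; split; [by rewrite !inE eqxx | by rewrite Ew eq_sym|].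
    have clo a b : avoid e [set w'] a b -> a \in K -> b \in K :|: set0.
      rewrite setU0 => /and3P[eab _ bw] aK; have := cut_closed eab aK.
      by rewrite inE -Ew (negPf bw) orbF.
    have czu : connect (avoid e [set w']) z u.
      by rewrite (sym_connect_sym (avoid_sym [set w'] sym)) Ew; rewrite inE in zK.
    case: (walk_region clo zK czu) => [ct|[t [? []]]]; last by rewrite inE.
    exact: (connect_mono (@touch_avoid e K [set w'])).
  have zI : z \in I by apply: (subsetP cut_subset); rewrite in_setD1 zu.
  have [t [tuv tw' ct]] := av z w' zI zw'.
  have clo a b : avoid e [set w'] a b -> a \in K -> b \in K :|: [set w].
    by move/avoid_sub; apply: cut_closed.
  have sub := connect_mono (@touch_avoid e K [set w']).
  have [ct'|[t' [z' [+ ct' _ _]]]] := walk_region clo zK ct; last first.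
    rewrite inE => /eqP Et; subst t'; exists w.
    by rewrite !inE eqxx orbT eq_sym; split=> //; apply: sub.
  exists t; split=> //; last exact: sub.
  have := cut_reach (@avoid_sub e [set w']) zK ct'.
  move: tuv; rewrite in_set2 => /orP[] /eqP ->; first by rewrite !inE eqxx.
  by rewrite (negPf vKw).
- by move=> x s es; apply: cyc; apply: sub_path es; apply: touch_sub.
- move=> p ep Up lp.
  have pK z : z \in u :: p -> z \in K :|: [set w].
    by move=> zp; apply: (cut_reach (fun _ _ => id) uK (path_connect ep zp)).
  have := pth (p ++ q); rewrite cat_path last_cat lp eq (sub_path (@touch_sub e K) ep).
  move=> /(_ isT) H; move: Er; rewrite -H ?size_cat //; first by move/eqP; rewrite eqn_modDr => /eqP.
  have [wq Uq'] : w \notin q /\ uniq q by case/andP: Uq.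
  rewrite -cat_cons cat_uniq Up Uq' andbT /=.
  apply/hasPn => z zq; apply: contraNN (qK z zq) => /pK.
  by rewrite in_setU in_set1 => /orP[//|/eqP Ez]; rewrite Ez (negPf wq) in zq.
Qed.
End Cut.

(** A link [s] between [P] and [Q] away from the terminals would complete a subdivided K4 with
    branch vertices [u], [a], [b], [v]. *)
Lemma two_paths_separated e u v I r P Q : linked e u v I r ->
  path e u (rcons P v) -> path e u (rcons Q v) -> uniq (u :: v :: P ++ Q) ->
  forall a b, a \in P -> b \in Q -> ~~ connect (avoid e [set u; v]) a b.
Proof.
move=> lk eP eQ U a0 b0 a0P b0Q; apply/negP => /connectP[p ep lp].
have [|||a [s [b [Pa Qb es Us ns]]]] := @subpath_between _ (mem P) (mem Q) _ _ ep.
- exact: a0P.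
- by rewrite -lp.
- move=> z zP; apply/negP => zQ.
  have : uniq (P ++ Q) by solve_uniq U.
  by rewrite cat_uniq => /and3P[_ /hasPn/(_ z zQ)/negP[]].
have suv z : z \in s -> z \notin [set u; v].
  by move=> zs; apply: (path_avoid_notin es); rewrite mem_rcons inE zs orbT.
have {}es := sub_path (@avoid_sub e [set u; v]) es.
have U' : uniq ((u :: v :: P ++ Q) ++ s).
  rewrite cat_uniq U /=; apply/andP; split; last first.
    by move: Us; rewrite /= rcons_uniq => /and3P[].
  apply/hasPn => z zs; have [/= zP zQ] := ns z zs; have := suv z zs.
  by rewrite !(mem_cat, inE) !negb_or zP zQ => /andP[-> ->].
move: Pa Qb => /= /splitPr EP /splitPr EQ.
case: EP eP U' {U ns} => P1 P2 eP U'; case: EQ eQ U' => Q1 Q2 eQ U'.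
move: eP eQ; rewrite !rcons_cat !rcons_cons !path_split => /andP[eP1 eP2] /andP[eQ1 eQ2].
(* The fourth branch vertex is [v] itself, so its path to [u] is the virtual edge alone. *)
apply: (@no_crossing_detours e u v r a b v P1 s Q2 [::] Q1 P2) => //.
- exact: linked_sym lk.
- exact: linked_cycle lk.
- exact: linked_path lk.
- by rewrite !path_split eP1 es eQ2.
- solve_uniq U'.
Qed.

(** Induction on the number of inner vertices: a separating vertex gives a series composition, two
    disjoint paths a parallel one. The congruence is proved along with it because it supplies the
    divisibility by 3 in [net_parallel]. *)
Lemma linked_net e u v I r : linked e u v I r ->
  net e u v I /\ #|I|.+1 = r %[mod 3].
Proof.
have [n le_n] := ubnP #|I|.
elim: n e u v I r le_n => // n IH e u v I r le_n lk.
(* An edge [uv] forces [r] to be 1 modulo 3 and is split off as a parallel piece without inner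
   vertices. *)
wlog nuv : e lk / ~~ e u v.
  move=> wl; case: (boolP (e u v)) => [euv|]; last exact: wl.
  have [sym irr supp uv uI vI c av cyc pth] := lk.
  have r1 : r = 1 %[mod 3].
    by rewrite -(pth [:: v]) //= ?euv ?inE ?uv ?andbT.
  have [I0|[z0 z0I]] := set_0Vmem I.
    rewrite I0 cards0 r1; split=> //; apply: net_edge => // x y.
    apply/idP/idP => [exy|/orP[]/andP[/eqP-> /eqP->] //]; last by rewrite sym.
    have eyx : e y x by rewrite sym.
    have := supp _ _ exy; have := supp _ _ eyx; move: exy; rewrite I0 !inE !orbF.
    by move=> h /orP[]/eqP E1 /orP[]/eqP E2; subst x y;
      first [by rewrite irr in h | by rewrite !eqxx /= ?orbT].
  have lk' : linked (touch e I) u v I r.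
    apply: (linked_component lk _ _ z0I) => // a b eab aI; rewrite sym in eab.
    by have := supp _ _ eab; rewrite setUA inE orbC -in_setU.
  have [|nt cI] := wl _ lk'; first by rewrite /touch /= euv (negPf uI) (negPf vI).
  split=> //.
  have I3 : 3 %| #|I| by move: cI; rewrite r1 /dvdn; clear; lia.
  rewrite -[I]set0U; pose e0 : rel T := fun x y => (x == u) && (y == v) || (x == v) && (y == u).
  apply: (@net_parallel e0 (touch e I)) => //.
  - exact: net_edge.
  - move=> x y; rewrite /e0 /touch /=.
    case: (boolP (e x y)) => /= [exy|nxy]; last first.
      by rewrite orbF; symmetry; apply/negbTE/negP => /orP[]/andP[/eqP Ex /eqP Ey]; subst x y;
        rewrite ?euv // sym euv in nxy.
    have eyx : e y x by rewrite sym.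
    move: (supp _ _ exy) (supp _ _ eyx); rewrite !inE.
    case: (x \in I); rewrite ?orbT //; case: (y \in I); rewrite ?orbT //= !orbF.
    by case/orP=> /eqP E1 /orP[]/eqP E2; subst x y;
      first [by rewrite irr in exy | by rewrite !eqxx /= ?orbT].
  - by rewrite disjoints_subset sub0set.
  - by rewrite cards0.
have [sym irr supp uv uI vI c av cyc pth] := lk.
have [[w [wu wv cut]]|[P [Q [eP eQ U]]]] := two_paths lk nuv.
  have lkC := linkedC lk.
  have cutC : ~~ connect (avoid e [set w]) v u.
    by rewrite (sym_connect_sym (avoid_sym [set w] sym)).
  set K1 := [set z | connect (avoid e [set w]) u z].
  set K2 := [set z | connect (avoid e [set w]) v z].
  have dK : [disjoint K1 & K2].
    apply/pred0P => z /=; rewrite !inE; apply: contraNF cut => /andP[cu cv].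
    by apply: connect_trans cu _; rewrite (sym_connect_sym (avoid_sym [set w] sym)).
  have [[w1 _] u1] := cut_notin wu cut.
  have [[w2 _] v2] := cut_notin wv cutC.
  have rv x q : last x q = w -> path e x q -> path e w (rev (belast x q)).
    move=> <-; rewrite rev_path; congr is_true; apply: eq_path => a b; exact: sym.
  have main x (K : {set T}) (K' : {set T}) q : [disjoint K' & K] -> w \notin K ->
      path (touch e K) x q -> uniq (x :: q) -> last x q = w -> {subset belast x q <= K} ->
      [/\ path e w (rev (belast x q)), uniq (w :: rev (belast x q)),
        last w (rev (belast x q)) = x & forall z, z \in rev (belast x q) -> z \notin K'].
    move=> dKK wK eq Uq lq sq.
    have Er : w :: rev (belast x q) = rev (x :: q).
      by rewrite -lq -rev_rcons -lastI.
    split.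
    - by apply: rv lq _; apply: sub_path eq; apply: touch_sub.
    - by rewrite Er rev_uniq.
    - by rewrite -[last _ _]/(last w (w :: _)) Er rev_cons last_rcons.
    - move=> z; rewrite mem_rev => /sq zK; apply/negP => zK'.
      by have /pred0P/(_ z) := dKK; rewrite /= zK zK'.
  have [q1 [eq1 Uq1 lq1 sq1]] := cut_path lk wu wv cut.
  have [q2 [eq2 Uq2 lq2 sq2]] := cut_path lkC wv wu cutC.
  have [eq2' Uq2' lq2' sq2'] := main _ _ _ _ dK w2 eq2 Uq2 lq2 sq2.
  rewrite disjoint_sym in dK.
  have [eq1' Uq1' lq1' sq1'] := main _ _ _ _ dK w1 eq1 Uq1 lq1 sq1.
  (* [r + 2 * size q2] represents [r - size q2] modulo 3 without truncated subtraction. *)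
  have lk1 := @linked_cut _ _ _ _ _ _ lk wu wv cut _ (r + 2 * size q2) eq2' Uq2' lq2' sq2'.
  have lk2 := @linked_cut _ _ _ _ _ _ lkC wv wu cutC _ (r + 2 * size q1) eq1' Uq1' lq1' sq1'.
  rewrite size_rev size_belast in lk1; rewrite size_rev size_belast in lk2.
  have {}lk1 := lk1 ltac:(clear; lia).
  have {}lk2 := linkedC (lk2 ltac:(clear; lia)).
  have wI : w \in I.
    have /connect_edge : connect (touch e K1) u w := linked_connect lk1.
    rewrite eq_sym => /(_ wu)[y /touch_sub]; rewrite sym => /supp.
    by rewrite !inE (negPf wu) (negPf wv).
  have s1 := cut_subset lk wu cut; have s2 := cut_subset lkC wv cutC.
  have lt1 : #|K1 :\ u| < n.
    rewrite -ltnS; apply: leq_trans le_n; rewrite ltnS; apply: proper_card.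
    by apply/properP; split=> //; exists w; rewrite // in_setD1 (negPf w1) andbF.
  have lt2 : #|K2 :\ v| < n.
    rewrite -ltnS; apply: leq_trans le_n; rewrite ltnS; apply: proper_card.
    by apply/properP; split=> //; exists w; rewrite // in_setD1 (negPf w2) andbF.
  have [nt1 c1] := IH _ _ _ _ _ lt1 lk1.
  have [nt2 c2] := IH _ _ _ _ _ lt2 lk2.
  have d12 : [disjoint u |: (K1 :\ u) & v |: (K2 :\ v)].
    by rewrite !setD1K // disjoint_sym.
  have cover z : z \in u |: (v |: I) -> z != w -> (z \in K1) || (z \in K2).
    move=> zV zw; move: zV; rewrite !in_setU1 => /or3P[/eqP->|/eqP->|zI].
    - by rewrite u1.
    - by rewrite v2 orbT.
    have [t [+ _ +]] := av z w zI zw.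
    rewrite (sym_connect_sym (avoid_sym [set w] sym)) in_set2.
    by case/orP=> /eqP->; rewrite !inE => ->; rewrite ?orbT.
  have EI : I = w |: ((K1 :\ u) :|: (K2 :\ v)).
    apply/setP => z; rewrite in_setU1 in_setU; apply/idP/idP.
      move=> zI; case: eqVneq => //= zw.
      have zu : z != u by apply: contraNneq uI => <-.
      have zv : z != v by apply: contraNneq vI => <-.
      have := cover z; rewrite !in_setU1 zI !orbT => /(_ isT zw).
      by rewrite !in_setD1 zu zv.
    by case/or3P => [/eqP->//|/(subsetP s1)|/(subsetP s2)].
  split.
    rewrite EI; apply: (net_series nt1 nt2) => // x y; apply/idP/orP; last first.
      by case=> /touch_sub.
    move=> exy; have exy' : e y x by rewrite sym.
    rewrite /touch /= exy /=.
    have [xw|/(cover _ (supp _ _ exy))/orP[->|->]] := eqVneq x w; [|by left|by right].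
    have yw : y != w by apply: contraTneq exy => ->; rewrite xw irr.
    by have /orP[->|->] := cover _ (supp _ _ exy') yw; rewrite orbT; [left|right].
  have cI : #|I| = (#|K1 :\ u| + #|K2 :\ v|).+1.
    rewrite EI cardsU1 cardsU disjoint_setI0 ?cards0 ?subn0.
      by rewrite in_setU !in_setD1 (negPf w1) (negPf w2) !andbF.
    move: d12; rewrite !disjoints_subset => /subsetP H; apply/subsetP => z zK.
    by have := H z; rewrite in_setU1 zK orbT setCU in_setI => /(_ isT)/andP[].
  (* Since [q1] is a path of the first piece, [size q1 + size q2] is [r] modulo 3, and the
     congruences of the two pieces add up. *)
  have r1 := linked_path lk1 eq1 Uq1 lq1.
  move: c1 c2 r1; rewrite cI; clear; lia.
case: P eP U => [|p P] eP U; first by move: eP; rewrite /= andbT (negPf nuv).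
case: Q eQ U => [|q Q] eQ U; first by move: eQ; rewrite /= andbT (negPf nuv).
have sep := two_paths_separated lk eP eQ U.
(* The component of [p] without the terminals misses [q] by [sep], so both [K] and the rest of [I]
   are smaller than [I]. *)
pose K := [set z | connect (avoid e [set u; v]) p z].
have pq : p \notin [set u; v] /\ q \notin [set u; v].
  have U1 : uniq ([:: u; v] ++ [:: p]) by solve_uniq U.
  have U2 : uniq ([:: u; v] ++ [:: q]) by solve_uniq U.
  move: U1 U2; rewrite !cat_uniq /= !orbF !andbT !inE => /andP[_ ->].
  by case/andP=> _ ->.
have pI z s : z \notin [set u; v] -> path e u (rcons (z :: s) v) -> z \in I.
  move=> zuv /= /andP[]; rewrite sym => /supp.
  by move: zuv; rewrite !inE negb_or => /andP[/negPf-> /negPf->].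
have pK : p \in K by rewrite inE connect0.
have Kuv z : z \in K -> z \notin [set u; v].
  rewrite inE => zK; have [<-|] := eqVneq p z; first by case: pq.
  by move=> /connect_edge/(_ zK)[y /and3P[]].
have KI : K \subset I.
  apply/subsetP => z zK; have := Kuv z zK.
  have [<-|pz] := eqVneq p z; first by move=> h; exact: pI eP.
  rewrite inE in zK; have [y /and3P[+ _ _]] := connect_edge pz zK.
  rewrite sym => /supp.
  by rewrite !inE negb_or => + /andP[/negPf zu /negPf zv]; rewrite zu zv.
have clo a b : e a b -> a \in K -> b \in K :|: [set u; v].
  move=> eab aK; rewrite in_setU orbC; case: (boolP (b \in _)) => //= buv.
  have auv := Kuv a aK.
  rewrite !inE in aK *; apply: connect_trans aK (connect1 _).
  by rewrite /avoid /= eab buv auv.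
have qK : q \in I :\: K.
  rewrite inE (pI _ _ _ eQ) ?andbT; last by case: pq.
  by rewrite inE; apply: sep; rewrite inE eqxx.
have cloD a b : e a b -> a \in I :\: K -> b \in (I :\: K) :|: [set u; v].
  move=> eab /setDP[aI aK]; rewrite in_setU in_setD.
  have bK : b \notin K.
    apply: contraNN aK => bK; have eba : e b a by rewrite sym.
    have := clo _ _ eba bK; rewrite in_setU => /orP[//|].
    by rewrite in_set2 => /orP[]/eqP E; rewrite -E aI in uI vI.
  rewrite sym in eab; have := supp _ _ eab.
  by rewrite bK !inE; case: (b \in I); rewrite ?orbT ?orbF.
have lk1 := linked_component lk KI clo pK.
have lk2 := linked_component lk (subsetDl I K) cloD qK.
have lt1 : #|K| < n.
  rewrite -ltnS; apply: leq_trans le_n; rewrite ltnS; apply: proper_card.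
  apply/properP; split=> //; exists q; first by case/setDP: qK.
  by case/setDP: qK.
have lt2 : #|I :\: K| < n.
  rewrite -ltnS; apply: leq_trans le_n; rewrite ltnS; apply: proper_card.
  apply/properP; split; first exact: subsetDl.
  by exists p; [apply: (subsetP KI) | rewrite in_setD pK].
have [nt1 c1] := IH _ _ _ _ _ lt1 lk1.
have [nt2 c2] := IH _ _ _ _ _ lt2 lk2.
have cI : #|I| = #|K| + #|I :\: K|.
  by rewrite -(cardsID K I) (setIidPr KI).
have rP := pth _ eP; have rQ := pth _ eQ.
(* The two paths close up to a cycle of length [2 * r] modulo 3, which must be 2. By [c1] and [c2]
   both pieces then have a multiple of 3 inner vertices. *)
have r1 : r = 1 %[mod 3].
  have := cyc u ((p :: P) ++ v :: rev (q :: Q)).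
  rewrite rcons_cat rcons_cons path_split eP path_rcons_rev // => /(_ isT).
  rewrite -[u :: _]/(u :: (p :: P) ++ v :: rev (q :: Q)).
  have -> : uniq (u :: (p :: P) ++ v :: rev (q :: Q)) by solve_uniq U.
  move: rP rQ; rewrite !last_rcons.
  have -> : uniq (u :: rcons (p :: P) v) by rewrite -cats1; solve_uniq U.
  have -> : uniq (u :: rcons (q :: Q) v) by rewrite -cats1; solve_uniq U.
  move=> /(_ isT erefl) + /(_ isT erefl) + /(_ isT).
  rewrite !size_rcons size_cat /= size_rev /=; clear; lia.
split; last by move: c1 c2 r1; rewrite cI; clear; lia.
have -> : I = K :|: (I :\: K) by rewrite setDE setUIr setUCr setIT; apply/esym/setUidPr.
apply: (net_parallel nt1 nt2).
- move=> x y; apply/idP/orP; last by case=> /touch_sub.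
  move=> exy; have eyx : e y x by rewrite sym.
  rewrite /touch /= exy /= !in_setD.
  move: (supp _ _ exy) (supp _ _ eyx).
  case: (x \in K); first by left. case: (y \in K); first by rewrite orbT; left.
  rewrite !inE /= => h1 h2; right; move: h1 h2.
  case: (x \in I) => //; case: (y \in I); rewrite ?orbT // !orbF.
  by case/orP=> /eqP E1 /orP[]/eqP E2; subst x y; move: exy eyx; rewrite ?irr // (negPf nuv).
- by rewrite disjoints_subset setCD subsetUr.
- by move: c1 r1; rewrite /dvdn; clear; lia.
- by move: c2 r1; rewrite /dvdn; clear; lia.
Qed.

End Networks.

(** * Domination in networks *)

Section Domination.
Variable T : finType.
Implicit Types (e : rel T) (u v w x y z : T) (A I : {set T}).

Definition domby e A x := [exists y in A, e x y].
Definition missed e A I := [set z in I | (z \notin A) && ~~ domby e A z].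

Lemma net_facts e u v I : net e u v I ->
  [/\ symmetric e, u != v, u \notin I, v \notin I &
      forall x y, e x y -> x \in u |: (v |: I)].
Proof.
elim=> {e u v I} [e u v uv Ee | e1 e2 e u w v I1 I2 _ [sy1 n1 u1 w1 s1] _ [sy2 n2 w2 v2 s2] Ee dI
  | e1 e2 e u v I1 I2 _ [sy1 n1 u1 v1 s1] _ [sy2 _ u2 v2 s2] Ee _ _ _].
- split; rewrite ?inE // => x y; first by rewrite !Ee orbC andbC [in X in _ || X]andbC.
  by rewrite Ee !inE => /orP[]/andP[-> _]; rewrite ?orbT.
- have := dI; rewrite disjoints_subset => /subsetP dI'.
  have ud : u \notin v |: I2 by have := dI' u; rewrite !inE eqxx; exact.
  move: ud; rewrite in_setU1 negb_or => /andP[uv uI2].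
  have vI1 : v \notin I1.
    by apply/negP => vI1; have := dI' v; rewrite !inE vI1 eqxx orbT => /(_ isT).
  split=> //.
  + by move=> x y; rewrite !Ee sy1 sy2.
  + by rewrite !inE !negb_or n1 u1.
  + by rewrite !inE !negb_or eq_sym n2 vI1.
  + move=> x y; rewrite Ee => /orP[/s1|/s2]; rewrite !inE => /or3P[] ->; rewrite ?orbT //.
- split=> //; try by rewrite inE negb_or ?u1 ?v1.
  + by move=> x y; rewrite !Ee sy1 sy2.
  + by move=> x y; rewrite Ee => /orP[/s1|/s2]; rewrite !inE => /or3P[] ->; rewrite ?orbT.
Qed.

Lemma dombyU e e1 e2 A x : (forall x y, e x y = e1 x y || e2 x y) ->
  domby e A x = domby e1 A x || domby e2 A x.
Proof.
move=> Ee; apply/idP/orP => [/existsP[y /andP[yA]]|].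
  by rewrite Ee => /orP[] h; [left|right]; apply/existsP; exists y; rewrite yA.
by case=> /existsP[y /andP[yA h]]; apply/existsP; exists y; rewrite yA Ee h ?orbT.
Qed.

Lemma domby_out e u v I A x : net e u v I -> x \notin u |: (v |: I) -> domby e A x = false.
Proof.
move=> /net_facts[_ _ _ _ supp] nx; apply/negbTE; apply: contraNN nx.
by case/existsP=> y /andP[_ /supp].
Qed.

Lemma domby_indep e A x : (forall y z, y \in A -> z \in A -> ~~ e y z) ->
  x \in A -> domby e A x = false.
Proof.
move=> ind xA; apply/negbTE/existsP => -[y /andP[yA]].
exact/negP/ind.
Qed.

Lemma missedU e A I1 I2 : [disjoint I1 & I2] ->
  #|missed e A (I1 :|: I2)| = #|missed e A I1| + #|missed e A I2|.
Proof.
move=> dI; rewrite -cardsUI.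
have -> : missed e A I1 :&: missed e A I2 = set0.
  apply/setP => z; rewrite !inE; apply/negbTE/negP => /andP[/andP[z1 _] /andP[z2 _]].
  by have /pred0P/(_ z) := dI; rewrite /= z1 z2.
rewrite cards0 addn0; congr #|pred_of_set _|; apply/setP => z.
by rewrite !inE andb_orl.
Qed.

Lemma eq_missed e e' A I : (forall x, x \in I -> domby e A x = domby e' A x) ->
  missed e A I = missed e' A I.
Proof. by move=> E; apply/setP => z; rewrite !inE; case zI: (z \in I) => //=; rewrite E. Qed.

Lemma cardIU A I1 I2 : [disjoint I1 & I2] ->
  #|A :&: (I1 :|: I2)| = #|A :&: I1| + #|A :&: I2|.
Proof.
move=> dI; rewrite setIUr -cardsUI.
have -> : A :&: I1 :&: (A :&: I2) = set0; last by rewrite cards0 addn0.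
by rewrite setIACA (disjoint_setI0 dI) setI0.
Qed.

Lemma cardU_disjoint I1 I2 : [disjoint I1 & I2] -> #|I1 :|: I2| = #|I1| + #|I2|.
Proof. by move=> dI; have := cardIU setT dI; rewrite !setTI. Qed.

Lemma net_series_disjoint e1 e2 u w v I1 I2 :
  net e1 u w I1 -> net e2 w v I2 -> [disjoint u |: I1 & v |: I2] ->
  [/\ [disjoint I1 & I2], [disjoint [set w] & I1 :|: I2],
     forall z, z \in u |: I1 -> z \notin w |: (v |: I2) &
     forall z, z \in v |: I2 -> z \notin u |: (w |: I1)].
Proof.
move=> /net_facts[_ n1 _ w1 _] /net_facts[_ n2 w2 _ _] dI.
have dI' z : z \in u |: I1 -> z \in v |: I2 -> False.
  by move=> z1 z2; have /pred0P/(_ z) := dI; rewrite /= z1 z2.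
split.
- apply/pred0P => z /=; apply/negP => /andP[z1 z2].
  by apply: (dI' z); rewrite inE ?z1 ?z2 orbT.
- by rewrite disjoints1 inE negb_or w1.
- move=> z z1; rewrite in_setU1 negb_or; apply/andP; split; last by apply/negP; exact: dI'.
  by apply: contraTneq z1 => ->; rewrite !inE negb_or eq_sym n1.
- move=> z z2; rewrite !in_setU1 !negb_or.
  have : z \notin u |: I1 by apply/negP => /dI'; apply.
  rewrite in_setU1 negb_or => /andP[-> ->]; rewrite andbT.
  by apply: contraTneq z2 => ->; rewrite !inE negb_or n2.
Qed.

(* In series the estimates simply add up. In parallel it is essential that both
   pieces have a multiple of 3 inner vertices, so that each estimate can be
   rounded up separately before adding. *)
Lemma net_lower e u v I A : net e u v I ->
  (forall x y, x \in A -> y \in A -> ~~ e x y) ->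
  #|missed e A I| <= 1 ->
  #|I| + domby e A u + domby e A v <=
    3 * #|A :&: I| + #|missed e A I| + (u \in A) + (v \in A).
Proof.
move=> nt; elim: nt => {e u v I} [e u v uv Ee ind _ | e1 e2 e u w v I1 I2 n1 IH1 n2 IH2 Ee dI ind
  | e1 e2 e u v I1 I2 n1 IH1 n2 IH2 Ee dI /dvdnP[m1 d1] /dvdnP[m2 d2] ind].
- have Du : domby e A u = (v \in A).
    apply/existsP/idP => [[y /andP[yA]]|vA].
      by rewrite Ee eqxx (negPf uv) orbF => /eqP<-.
    by exists v; rewrite vA Ee !eqxx.
  have Dv : domby e A v = (u \in A).
    apply/existsP/idP => [[y /andP[yA]]|uA].
      by rewrite Ee eqxx eq_sym (negPf uv) => /eqP<-.
    by exists u; rewrite uA Ee !eqxx orbT.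
  by rewrite Du Dv cards0; clear; lia.
- have [d12 dw o1 o2] := net_series_disjoint n1 n2 dI.
  have ind1 x y : x \in A -> y \in A -> ~~ e1 x y.
    by move=> xA yA; have := ind x y xA yA; rewrite Ee negb_or => /andP[].
  have ind2 x y : x \in A -> y \in A -> ~~ e2 x y.
    by move=> xA yA; have := ind x y xA yA; rewrite Ee negb_or => /andP[].
  have D1 z : z \in u |: I1 -> domby e A z = domby e1 A z.
    by move=> /o1 h; rewrite (dombyU _ _ Ee) (domby_out _ n2 h) orbF.
  have D2 z : z \in v |: I2 -> domby e A z = domby e2 A z.
    by move=> /o2 h; rewrite (dombyU _ _ Ee) (domby_out _ n1 h).
  rewrite (missedU _ _ dw) (missedU _ _ d12) (cardIU _ dw) (cardIU _ d12) (cardU_disjoint dw) (cardU_disjoint d12).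
  rewrite (@eq_missed e e1 A I1) => [|x xI]; last by rewrite D1 // inE xI orbT.
  rewrite (@eq_missed e e2 A I2) => [|x xI]; last by rewrite D2 // inE xI orbT.
  rewrite D1 ?setU11 // D2 ?setU11 // cards1.
  move: (IH1 ind1) (IH2 ind2).
  have -> : #|missed e A [set w]| = (w \notin A) && ~~ (domby e1 A w || domby e2 A w).
    rewrite -(dombyU _ _ Ee); case: (boolP (_ && _)) => h.
      have -> : missed e A [set w] = [set w]; last by rewrite cards1.
      by apply/setP => z; rewrite !inE; case: eqP => //= ->.
    have -> : missed e A [set w] = set0; last by rewrite cards0.
    by apply/setP => z; rewrite !inE; case: eqP => //= ->; apply: negPf.
  have -> : #|A :&: [set w]| = (w \in A).
    case: (boolP (w \in A)) => h; first by rewrite (setIidPr _) ?sub1set ?cards1.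
    by rewrite setIC disjoint_setI0 ?cards0 // disjoints1.
  (* The common terminal [w] becomes an inner vertex. If it is in [A], it has no neighbour there and
     its weight rises from 2 to 3; otherwise it is dominated from a side or counted as missed. *)
  have := domby_indep ind1 (x := w); have := domby_indep ind2 (x := w).
  case: (w \in A) => [/(_ isT)-> /(_ isT)->|_ _] /=.
    by clear; lia.
  by case: (domby e1 A w); case: (domby e2 A w); clear; lia.
- have ind1 x y : x \in A -> y \in A -> ~~ e1 x y.
    by move=> xA yA; have := ind x y xA yA; rewrite Ee negb_or => /andP[].
  have ind2 x y : x \in A -> y \in A -> ~~ e2 x y.
    by move=> xA yA; have := ind x y xA yA; rewrite Ee negb_or => /andP[].
  have [_ _ u1 v1 _] := net_facts n1; have [_ _ u2 v2 _] := net_facts n2.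
  have dI' z : z \in I1 -> z \in I2 -> False.
    by move=> z1 z2; have /pred0P/(_ z) := dI; rewrite /= z1 z2.
  have D1 z : z \in I1 -> domby e A z = domby e1 A z.
    move=> z1; rewrite (dombyU _ _ Ee) (domby_out _ n2) ?orbF // !in_setU1 !negb_or.
    apply/and3P; split; last by apply/negP; apply: dI'.
      by apply: contraNneq u1 => <-.
    by apply: contraNneq v1 => <-.
  have D2 z : z \in I2 -> domby e A z = domby e2 A z.
    move=> z2; rewrite (dombyU _ _ Ee) (domby_out _ n1) // !in_setU1 !negb_or.
    apply/and3P; split; last by apply/negP => z1; apply: dI' z1 z2.
      by apply: contraNneq u2 => <-.
    by apply: contraNneq v2 => <-.
  rewrite (missedU _ _ dI) (cardIU _ dI) (cardU_disjoint dI).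
  rewrite (@eq_missed e e1 A I1) // (@eq_missed e e2 A I2) //.
  rewrite !(dombyU _ _ Ee); move: (IH1 ind1) (IH2 ind2); rewrite d1 d2.
  (* A terminal in [A] has no neighbour in [A], and at most one of the two estimates contains a
     missed vertex before rounding. *)
  have := domby_indep ind1 (x := u); have := domby_indep ind2 (x := u).
  have := domby_indep ind1 (x := v); have := domby_indep ind2 (x := v).
  case: (u \in A) => [+ + /(_ isT)-> /(_ isT)->|+ + _ _];
    case: (v \in A) => [/(_ isT)-> /(_ isT)->|_ _] /=;
    case: (domby e1 A u); case: (domby e2 A u); case: (domby e1 A v); case: (domby e2 A v);
    rewrite /=; clear; lia.
Qed.

(* [c] is the level of [u]; the set consists of the vertices whose level is
   divisible by 3. *)
Lemma net_upper e u v I (c : nat) : net e u v I ->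
  exists A, [/\ A \subset u |: (v |: I),
    (forall x y, x \in A -> y \in A -> ~~ e x y),
    (u \in A) = (c %% 3 == 0) /\ (v \in A) = ((c + #|I|.+1) %% 3 == 0),
    [/\ forall z, z \in I -> (z \in A) || domby e A z,
        c %% 3 = 2 -> domby e A u & (c + #|I|.+1) %% 3 = 1 -> domby e A v] &
    #|A :&: I| + c %/ 3 = (c + #|I|) %/ 3].
Proof.
move=> nt; elim: nt c => {e u v I} [e u v uv Ee | e1 e2 e u w v I1 I2 n1 IH1 n2 IH2 Ee dI
  | e1 e2 e u v I1 I2 n1 IH1 n2 IH2 Ee dI /dvdnP[m1 d1] /dvdnP[m2 d2]] c.
- have vu : (v == u) = false by rewrite eq_sym (negPf uv).
  (* The levels of [u] and [v] are [c] and [c.+1]. *)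
  exists [set z | (z == u) && (c %% 3 == 0) || (z == v) && (c.+1 %% 3 == 0)].
  rewrite cards0 !inE !eqxx (negPf uv) vu /= orbF addn1 setI0 cards0 addn0 add0n.
  have ne : ~~ ((c %% 3 == 0) && (c.+1 %% 3 == 0)) by clear; lia.
  split=> //.
  + by apply/subsetP => z; rewrite !inE => /orP[]/andP[-> _]; rewrite ?orbT.
  + move=> x y; rewrite !inE Ee => hx hy; apply: contraNN ne.
    by case/orP=> /andP[/eqP Ex /eqP Ey]; move: hx hy; rewrite Ex Ey !eqxx vu
      (negPf uv) /= ?orbF => -> ->.
  + split=> [z|c2|c1]; first by rewrite in_set0.
      apply/existsP; exists v; rewrite Ee !inE !eqxx vu /=.
      by move: c2; clear; lia.
    apply/existsP; exists u; rewrite Ee !inE !eqxx /= (negPf uv) /= orbF orbT andbT.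
    by move: c1; clear; lia.
- have [d12 dw o1 o2] := net_series_disjoint n1 n2 dI.
  have [A1 [sA1 i1 [u1 w1] [dom1 du1 dw1] k1]] := IH1 c.
  (* The second piece starts at the level that the first one gives to [w], so the two sets agree on
     [w]. *)
  have [A2 [sA2 i2 [w2 v2] [dom2 dw2 dv2] k2]] := IH2 (c + #|I1|.+1).
  have out1 z : z \in u |: I1 -> z \notin A2.
    by move/o1; apply: contraNN; apply: subsetP.
  have out2 z : z \in v |: I2 -> z \notin A1.
    by move/o2; apply: contraNN; apply: subsetP.
  have w12 : (w \in A1) = (w \in A2) by rewrite w1 w2.
  have in1 z : z \in u |: (w |: I1) -> z \in A1 :|: A2 -> z \in A1.
    move=> z1; rewrite inE => /orP[//|z2]; have [Ez|zw] := eqVneq z w.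
      by rewrite Ez w12 -Ez.
    by move: z1; rewrite setUCA in_setU1 (negPf zw) => /out1; rewrite z2.
  have in2 z : z \in w |: (v |: I2) -> z \in A1 :|: A2 -> z \in A2.
    move=> z1; rewrite inE => /orP[z2|//]; have [Ez|zw] := eqVneq z w.
      by rewrite Ez -w12 -Ez.
    by move: z1; rewrite in_setU1 (negPf zw) => /out2; rewrite z2.
  have [sy1 _ _ _ s1] := net_facts n1; have [sy2 _ _ _ s2] := net_facts n2.
  have dmono1 z : domby e1 A1 z -> domby e (A1 :|: A2) z.
    case/existsP=> y /andP[yA ezy]; apply/existsP; exists y.
    by rewrite inE yA Ee ezy.
  have dmono2 z : domby e2 A2 z -> domby e (A1 :|: A2) z.
    case/existsP=> y /andP[yA ezy]; apply/existsP; exists y.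
    by rewrite inE yA Ee ezy !orbT.
  have cI : #|w |: (I1 :|: I2)| = (#|I1| + #|I2|).+1.
    by rewrite (cardU_disjoint dw) (cardU_disjoint d12) cards1.
  exists (A1 :|: A2); split.
  + rewrite subUset; apply/andP; split.
      by apply: subset_trans sA1 _; apply/subsetP => z; rewrite !inE => /or3P[]->; rewrite ?orbT.
    by apply: subset_trans sA2 _; apply/subsetP => z; rewrite !inE => /or3P[]->; rewrite ?orbT.
  + move=> x y xA yA; rewrite Ee negb_or; apply/andP; split; apply/negP => exy.
      have eyx : e1 y x by rewrite sy1.
      by have /negP := i1 x y (in1 _ (s1 _ _ exy) xA) (in1 _ (s1 _ _ eyx) yA).
    have eyx : e2 y x by rewrite sy2.
    by have /negP := i2 x y (in2 _ (s2 _ _ exy) xA) (in2 _ (s2 _ _ eyx) yA).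
  + rewrite !in_setU (negPf (out1 u _)) ?setU11 // (negPf (out2 v _)) ?setU11 // orbF u1 v2 cI.
    by split=> //; congr (_ %% 3 == 0); clear; lia.
  + rewrite cI; split.
    * move=> z; rewrite in_setU1 !in_setU => /or3P[/eqP->|/dom1|/dom2].
      - rewrite -w12 orbb w1.
        (* At level 1 modulo 3, [w] is dominated from the first piece; at level 2, from the
           second. *)
        case: eqP => //= ne; have [c1|c2] : (c + #|I1|.+1) %% 3 = 1 \/ (c + #|I1|.+1) %% 3 = 2.
          by move: ne; clear; lia.
        by apply: dmono1; apply: dw1.
        by apply: dmono2; apply: dw2.
      - by case/orP=> [->//|/dmono1->]; rewrite orbT.
      - by case/orP=> [->//|/dmono2->]; rewrite orbT ?orbT.
    * by move=> /du1/dmono1.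
    * move=> c1; apply: dmono2; apply: dv2; move: c1; clear; lia.
  + have -> : #|(A1 :|: A2) :&: (w |: (I1 :|: I2))| = (w \in A1) + #|A1 :&: I1| + #|A2 :&: I2|.
      rewrite (cardIU _ dw) (cardIU _ d12) addnA; congr (_ + _ + _).
      - case: (boolP (w \in A1)) => h; first by rewrite (setIidPr _) ?sub1set ?cards1 // inE h.
        by rewrite setIC disjoint_setI0 ?cards0 // disjoints1 inE -w12 orbb.
      - congr #|pred_of_set _|; apply/setP => z; rewrite !inE.
        case zI: (z \in I1); rewrite ?andbF // !andbT.
        by rewrite (negPf (out1 z _)) ?orbF // inE zI orbT.
      - congr #|pred_of_set _|; apply/setP => z; rewrite !inE.
        case zI: (z \in I2); rewrite ?andbF // !andbT.
        by rewrite (negPf (out2 z _)) // inE zI orbT.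
    (* The count is the number of multiples of 3 from [c + 1] to [c + #|I|]; here [w] accounts for
       [c + #|I1| + 1]. *)
    rewrite cI; move: w1 k1 k2; clear; case: (w \in A1); lia.
- have [A1 [sA1 i1 [u1 v1] [dom1 du1 dv1] k1]] := IH1 c.
  have [A2 [sA2 i2 [u2 v2] [dom2 du2 dv2] k2]] := IH2 c.
  have [sy1 uv uI1 vI1 s1] := net_facts n1; have [sy2 _ uI2 vI2 s2] := net_facts n2.
  have dI' z : z \in I1 -> z \in I2 -> False.
    by move=> z1 z2; have /pred0P/(_ z) := dI; rewrite /= z1 z2.
  have uu : (u \in A1) = (u \in A2) by rewrite u1 u2.
  (* As [#|I1|] and [#|I2|] are multiples of 3, both pieces give [v] the same level modulo 3. *)
  have vv : (v \in A1) = (v \in A2).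
    rewrite v1 v2 d1 d2; clear; lia.
  have in1 z : z \in u |: (v |: I1) -> z \in A1 :|: A2 -> z \in A1.
    rewrite !in_setU !in_set1 => /or3P[/eqP->|/eqP->|z1].
    - by rewrite -uu orbb.
    - by rewrite -vv orbb.
    case/orP=> // /(subsetP sA2); rewrite !in_setU1.
    by case/or3P=> [/eqP E|/eqP E|/(dI' _ z1) //]; rewrite -E z1 in uI1 vI1.
  have in2 z : z \in u |: (v |: I2) -> z \in A1 :|: A2 -> z \in A2.
    rewrite !in_setU !in_set1 => /or3P[/eqP->|/eqP->|z1].
    - by rewrite -uu orbb uu.
    - by rewrite -vv orbb vv.
    case/orP=> // /(subsetP sA1); rewrite !in_setU1.
    by case/or3P=> [/eqP E|/eqP E|/dI'/(_ z1) //]; rewrite -E z1 in uI2 vI2.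
  have dmono1 z : domby e1 A1 z -> domby e (A1 :|: A2) z.
    case/existsP=> y /andP[yA ezy]; apply/existsP; exists y.
    by rewrite inE yA Ee ezy.
  have cI := cardU_disjoint dI.
  have dmono2 z : domby e2 A2 z -> domby e (A1 :|: A2) z.
    case/existsP=> y /andP[yA ezy]; apply/existsP; exists y.
    by rewrite inE yA Ee ezy !orbT.
  exists (A1 :|: A2); split.
  + rewrite subUset; apply/andP; split.
      by apply: subset_trans sA1 _; apply/subsetP => z; rewrite !inE => /or3P[]->; rewrite ?orbT.
    by apply: subset_trans sA2 _; apply/subsetP => z; rewrite !inE => /or3P[]->; rewrite ?orbT.
  + move=> x y xA yA; rewrite Ee negb_or; apply/andP; split; apply/negP => exy.
      have eyx : e1 y x by rewrite sy1.
      by have /negP := i1 x y (in1 _ (s1 _ _ exy) xA) (in1 _ (s1 _ _ eyx) yA).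
    have eyx : e2 y x by rewrite sy2.
    by have /negP := i2 x y (in2 _ (s2 _ _ exy) xA) (in2 _ (s2 _ _ eyx) yA).
  + rewrite !in_setU -uu -vv !orbb u1 v1 cI d1 d2; split=> //; clear; lia.
  + rewrite cI; split.
    * move=> z; rewrite !in_setU => /orP[/dom1|/dom2].
      - by case/orP=> [->//|/dmono1->]; rewrite orbT.
      - by case/orP=> [->//|/dmono2->]; rewrite orbT ?orbT.
    * by move=> /du1/dmono1.
    * move=> c1; apply: dmono1; apply: dv1; move: c1; rewrite d1 d2; clear; lia.
  + rewrite (cardIU _ dI).
    have -> : (A1 :|: A2) :&: I1 = A1 :&: I1.
      apply/setP => z; rewrite !in_setI; case zI: (z \in I1); rewrite ?andbF // !andbT.
      by apply/idP/idP => [|z1]; [apply: in1; rewrite !inE zI !orbT | rewrite inE z1].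
    have -> : (A1 :|: A2) :&: I2 = A2 :&: I2.
      apply/setP => z; rewrite !in_setI; case zI: (z \in I2); rewrite ?andbF // !andbT.
      by apply/idP/idP => [|z1]; [apply: in2; rewrite !inE zI !orbT | rewrite inE z1 orbT].
    move: k1 k2; rewrite cI d1 d2; clear; lia.
Qed.
End Domination.

(** * The theorem *)

Implicit Type G : sgraph.

(** * From graphs to networks *)

Lemma connect_del_vertex G (w : G) (a b : del_vertex w) :
  connect adj a b -> connect (avoid adj [set w]) (val a) (val b).
Proof.
case/connectP=> p + ->; elim: p a => //= c p IH a /andP[ac /IH]; apply: connect_trans.
apply: connect1; rewrite /avoid /= !inE (valP a) (valP c) !andbT; exact: ac.
Qed.

Lemma ternary_size G (c : seq G) : ternary01 G -> cycle adj c -> uniq c ->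
  2 < size c -> size c = 2 %[mod 3].
Proof.
move=> Gt cc Uc sc; have : size c %% 3 < 3 by rewrite ltn_mod.
have n0 : size c %% 3 <> 0.
  by move=> E; apply: Gt; exists c; [split; rewrite // /ucycle cc | left].
have n1 : size c %% 3 <> 1.
  by move=> E; apply: Gt; exists c; [split; rewrite // /ucycle cc | right].
by case: (size c %% 3) n0 n1 => [|[|[|]]].
Qed.

Lemma two_connected_linked G (u v : G) r : two_connected G -> ternary01 G -> u != v ->
  (forall p, path adj u p -> uniq (u :: p) -> last u p = v -> size p = r %[mod 3]) ->
  linked adj u v (~: [set u; v]) r.
Proof.
move=> G2 Gt uv pth; split=> //.
- exact: adj_sym.
- exact: adj_irr.
- by move=> x y _; rewrite setUA setUCr inE.
- by rewrite !inE eqxx.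
- by rewrite !inE eqxx orbT.
- by case: G2 => [[_ K2]|[_ cG _]]; [apply/connect1/K2 | apply: cG].
- move=> z w; rewrite in_setC => zuv zw.
  case: G2 => [[G2 _]|[_ _ cGw]].
    have : #|z |: [set u; v]| <= #|G| by apply: max_card.
    by rewrite cardsU1 zuv cards2 uv G2.
  have [t [tuv tw]] : exists t : G, t \in [set u; v] /\ t != w.
    have [uw|] := eqVneq u w; last by exists u; rewrite !inE eqxx.
    by exists v; rewrite !inE eqxx orbT -uw eq_sym.
  exists t; split=> //.
  exact: (connect_del_vertex (cGw w (Sub z zw) (Sub t tw))).
- move=> x s es Us ls; have := @ternary_size _ (x :: s) Gt es Us ls.
  by rewrite /= -addn1 -[X in _ = X %[mod 3]]/(1 + 1) => /eqP; rewrite eqn_modDr => /eqP.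
Qed.

(** The edge [uv] closes a path of at least two edges to a cycle, of length 2 modulo 3. *)
Lemma edge_path_size G (u v : G) p : ternary01 G -> adj u v ->
  path adj u p -> uniq (u :: p) -> last u p = v -> size p = 1 %[mod 3].
Proof.
move=> Gt uv ep Up lp; case: p ep Up lp => [|a [|b p]] //.
  by move=> _ _ E; rewrite -E /= adj_irr in uv.
set q := a :: b :: p => ep Up lp.
have cq : cycle adj (u :: q).
  rewrite -[cycle adj _]/(path adj u (rcons q u)) rcons_path lp adj_sym uv andbT.
  exact: ep.
have := ternary_size Gt cq Up isT.
by rewrite [size (u :: q)]/= -addn1 -[X in _ = X %[mod 3]]/(1 + 1) => /eqP; rewrite eqn_modDr => /eqP.
Qed.

Lemma ear_path G (u v : G) k (uv : u != v) : 0 < k ->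
  exists s : seq 'I_k, [/\ path (@adj (add_ear k uv)) (inl u) (rcons (map inr s) (inl v)),
    uniq s & size s = k].
Proof.
move=> k0.
(* The rest of the ear after [i] uses larger indices only, which keeps the path simple. *)
have H n (i : 'I_k) : k - i <= n -> exists s : seq 'I_k,
    [/\ path (@adj (add_ear k uv)) (inr i) (rcons (map inr s) (inl v)), uniq s,
      forall j : 'I_k, j \in s -> i < j & size s = k - i.+1].
  elim: n i => [|n IH] i ki; first by move: (ltn_ord i) ki; clear; lia.
  have [ik|ik] := ltnP i.+1 k; last first.
    exists [::]; split=> //; last by move: ik; clear; rewrite /=; lia.
    have Ek : i.+1 = k by apply/eqP; rewrite eqn_leq ik ltn_ord.
    by rewrite /= /ear_adj /= Ek !eqxx.
  have [|s [es Us ls ss]] := IH (Ordinal ik); first by move: ki ik; rewrite /=; clear; lia.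
  exists (Ordinal ik :: s); split.
  - rewrite /= es /ear_adj /= eqxx //.
  - by rewrite /= Us andbT; apply/negP => /ls; rewrite ltnn.
  - by move=> j; rewrite inE => /orP[/eqP->//|/ls] /=; apply: leq_trans.
  - by rewrite /= ss /= subnSK.
have [s [es Us ls ss]] := H _ (Ordinal k0) (leqnn _).
exists (Ordinal k0 :: s); split.
- by rewrite /= es /ear_adj /= !eqxx.
- by rewrite /= Us andbT; apply/negP => /ls; rewrite ltnn.
- by rewrite /= ss /= subn1 prednK.
Qed.

(** With the ear, [p] forms a cycle of length [size p + k + 1], which is 2 modulo 3; hence the
    residue [1 + 2 * k]. *)
Lemma admissible_path_size G (u v : G) : admissible u v ->
  u != v /\ exists r, forall p, path adj u p -> uniq (u :: p) -> last u p = v ->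
    size p = r %[mod 3].
Proof.
case=> uv [k [knadj _ Et]]; split=> //; exists (1 + 2 * k) => p ep Up lp.
have [s [es Us ss]] : exists s : seq 'I_k, [/\
    path (@adj (add_ear k uv)) (inl u) (rcons (map inr s) (inl v)), uniq s & size s = k].
  have [k0|k0] := posnP k; last exact: ear_path.
  by exists [::]; rewrite k0 /= /ear_adj /= !eqxx orbT.
have Er : rev (u :: p) = v :: rev (belast u p) by rewrite lastI lp rev_rcons.
have ev : path adj v (rev (belast u p)).
  by rewrite -lp rev_path (eq_path (e' := adj)) // => a b; apply: adj_sym.
pose c : seq (add_ear k uv) := inl u :: map inr s ++ map inl (rev p).
have cc : cycle adj c.
  rewrite /c /= rcons_cat -map_rcons -rev_cons Er /= path_split es /=.
  by rewrite path_map; apply: sub_path ev => a b ab; rewrite /= /ear_adj /= ab.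
have Uc : uniq c.
  suff : perm_eq c (map inl (u :: p) ++ map inr s).
    move/perm_uniq => ->; rewrite cat_uniq !map_inj_uniq ?Up ?Us ?andbT; last first.
    - by move=> a b [].
    - by move=> a b [].
    by apply/hasPn => z /mapP[a _ ->]; apply/mapP => -[].
  rewrite /c /= perm_cons perm_catC perm_cat2r.
  by apply: perm_map; rewrite perm_rev.
have sc : size c = (k + size p).+1 by rewrite /= size_cat !size_map size_rev ss.
(* If [p] is a single edge, [knadj] forces the ear to have inner vertices. *)
have lt2 : 2 < size c.
  rewrite sc; case: p ep lp {Up Er ev c cc Uc sc} => [|a [|b p]] /=.
  - by move=> _ E; have := uv; rewrite E eqxx.
  - by rewrite andbT => ua E; case: (posnP k) => [/knadj|]; [rewrite -E ua | clear; lia].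
  - by move=> _ _; clear; lia.
have := ternary_size Et cc Uc lt2; rewrite sc; clear; lia.
Qed.

Lemma independentP G (A : {set G}) :
  reflect (forall x y, x \in A -> y \in A -> ~~ adj x y) (independent A).
Proof.
apply: (iffP forall_inP) => [H x y xA yA|H x xA]; first by have /forall_inP := H x xA; apply.
by apply/forall_inP => y yA; apply: H.
Qed.

Lemma dominatingP G (A : {set G}) :
  reflect (forall x, (x \in A) || domby adj A x) (dominating A).
Proof. exact: forallP. Qed.

Lemma idom_le G (A : {set G}) : indep_dom A -> idom G <= #|A|.
Proof.
move=> iA; rewrite /idom; case: ex_minnP => k _; apply.
by apply/existsP; exists A; rewrite iA eqxx.
Qed.

Lemma idom_exists G : exists2 A : {set G}, indep_dom A & #|A| = idom G.
Proof.
rewrite /idom; case: ex_minnP => k /existsP[A /andP[iA /eqP Ak]] _.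
by exists A.
Qed.

(** * Cardinalities of independent dominating sets *)

Section Counting.
Variables (m : nat) (G : sgraph).
Hypotheses (cardG : #|G| = 3 * m + 2) (G2 : two_connected G) (Gt : ternary01 G).

Lemma card_terminals (u v : G) (A : {set G}) : u != v ->
  #|A| = #|A :&: ~: [set u; v]| + (u \in A) + (v \in A).
Proof.
move=> uv; rewrite -addnA -setDE -(cardsID [set u; v] A) addnC; congr (_ + _).
rewrite (cardsD1 u) (cardsD1 v) !inE !eqxx [v == u]eq_sym uv /= orbT !andbT.
rewrite [X in _ + (_ + X)](_ : _ = 0) ?addn0 //.
apply/eqP; rewrite cards_eq0; apply/eqP/setP => z; rewrite !inE.
by case: (z == u); case: (z == v); rewrite ?andbF.
Qed.

Lemma card_interior (u v : G) : u != v -> #|~: [set u; v]| = 3 * m.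
Proof. by move=> uv; have := cardsC [set u; v]; rewrite cards2 uv cardG; clear; lia. Qed.

Lemma edge_net (u v : G) : adj u v -> net adj u v (~: [set u; v]).
Proof.
move=> uv; have ne : u != v by apply: contraTneq uv => ->; rewrite adj_irr.
apply: (proj1 (linked_net (two_connected_linked G2 Gt ne _))).
by move=> p; apply: edge_path_size.
Qed.

Lemma missed0 (A I : {set G}) : (forall x, x \in I -> (x \in A) || domby adj A x) ->
  #|missed adj A I| = 0.
Proof.
move=> H; apply/eqP; rewrite cards_eq0; apply/eqP/setP => z; rewrite !inE -negb_or.
by case: (boolP (z \in I)) => //= /H ->.
Qed.

Lemma neighbor_exists (x : G) : exists y, adj x y.
Proof.
have [y yx] : exists y, y != x.
  have : 0 < #|[set~ x]| by rewrite cardsC1 cardG; clear; lia.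
  by case/card_gt0P => y; rewrite !inE; exists y.
case: G2 => [[_ K2]|[_ cG _]]; first by exists y; apply: K2; rewrite eq_sym.
have [z] := connect_edge yx (cG y x).
by rewrite adj_sym; exists z.
Qed.

(** With [x] as a terminal, [net_lower] does not ask that [x] be dominated, so one bound serves both
    [i(G)] and [i(G - x)]. *)
Lemma almost_dominating_card (x : G) (A : {set G}) : independent A ->
  (forall z, z != x -> (z \in A) || domby adj A z) -> m + 1 <= #|A|.
Proof.
move=> /independentP ind dom; have [y xy] := neighbor_exists x.
have ne : x != y by apply: contraTneq xy => ->; rewrite adj_irr.
have M0 : #|missed adj A (~: [set x; y])| = 0.
  by apply: missed0 => z; rewrite !inE negb_or => /andP[zx _]; apply: dom.
have := net_lower (edge_net xy) ind; rewrite M0 => /(_ isT).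
rewrite (card_terminals A ne) (card_interior ne) addn0.
have := dom y; rewrite eq_sym => /(_ ne).
have dx : y \in A -> domby adj A x.
  by move=> yA; apply/existsP; exists y; rewrite yA.
have dy : x \in A -> domby adj A y.
  by move=> xA; apply/existsP; exists x; rewrite xA adj_sym.
(* A terminal in [A] adds one to at least [m] inner vertices. If neither is in [A], then [y] is
   dominated and at least [m + 1] inner vertices are in [A]. *)
case xA: (x \in A) dx dy; case yA: (y \in A).
- by rewrite (negPf (ind _ _ xA yA)) in xy.
- by move=> _ ->// _; clear; lia.
- by move=> -> // _ _; clear; lia.
- by move=> _ _ /= ->; clear; lia.
Qed.

(** With [x] at level 0, its neighbour [y] gets level [3 * m + 1]: outside the set but dominated.
    The set is [x] and [m] inner vertices. *)
Lemma indep_dom_through (x : G) :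
  exists A : {set G}, [/\ indep_dom A, #|A| = m + 1 & x \in A].
Proof.
have [y xy] := neighbor_exists x.
have ne : x != y by apply: contraTneq xy => ->; rewrite adj_irr.
have [A [_ ind [xA yA] [dom _ dy] cA]] := net_upper 0 (edge_net xy).
rewrite (card_interior ne) in yA dy cA; rewrite /= in xA.
have Ey : (y \in A) = false by rewrite yA; clear; lia.
exists A; split.
- apply/andP; split; first exact/independentP.
  apply/dominatingP => z; have [->|zx] := eqVneq z x; first by rewrite xA.
  have [->|zy] := eqVneq z y; last by apply: dom; rewrite !inE negb_or zx.
  by rewrite Ey dy //; clear; lia.
- by rewrite (card_terminals A ne) xA Ey; move: cA; clear; lia.
- by rewrite xA.
Qed.

Lemma idom_card : idom G = m + 1.
Proof.
have [x _] : exists x : G, x \in G by apply/card_gt0P; rewrite cardG; clear; lia.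
have [B [iB cB _]] := indep_dom_through x.
apply/eqP; rewrite eqn_leq -{1}cB idom_le //=.
have [A /andP[indA /dominatingP domA] <-] := idom_exists G.
by apply: (@almost_dominating_card x) => // z _; apply: domA.
Qed.

(** With both terminals in [A], [net_lower] leaves a surplus of only 2, so [A] has at least [m]
    inner vertices besides [u] and [v]. *)
Lemma admissible_indep_dom_card (A : {set G}) u v :
  indep_dom A -> u \in A -> v \in A -> admissible u v -> m + 2 <= #|A|.
Proof.
move=> /andP[/independentP ind /dominatingP dom] uA vA /admissible_path_size[uv [r pth]].
have [nt _] := linked_net (two_connected_linked G2 Gt uv pth).
have M0 : #|missed adj A (~: [set u; v])| = 0 by apply: missed0 => z _; apply: dom.
have := net_lower nt ind; rewrite M0 => /(_ isT).
by rewrite (card_terminals A uv) (card_interior uv) uA vA; clear; lia.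
Qed.

Lemma idom_del_vertex (x : G) : m + 1 <= idom (del_vertex x).
Proof.
have [A /andP[/independentP ind /dominatingP dom] <-] := idom_exists (del_vertex x).
pose B : {set G} := [set val a | a in A].
have -> : #|A| = #|B| by rewrite card_imset //; apply: val_inj.
apply: (@almost_dominating_card x).
  apply/independentP => y z /imsetP[a aA ->] /imsetP[b bA ->]; exact: (ind a b aA bA).
move=> z zx; have /orP[zA|/existsP[b /andP[bA zb]]] := dom (Sub z zx).
  by apply/orP; left; apply/imsetP; exists (Sub z zx).
apply/orP; right; apply/existsP; exists (val b).
by rewrite imset_f.
Qed.
End Counting.

Theorem theorem3p2 (m : nat) (G : sgraph)
    (cardG : #|G| = 3 * m + 2) (G2c : two_connected G) (Gt : ternary01 G) :
  [/\ idom G = m + 1,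
      forall A : {set G}, min_indep_dom A ->
        ~ exists u v : G, [/\ u \in A, v \in A & admissible u v],
      forall x : G, idom (del_vertex x) >= idom G
    & forall x : G, exists2 A : {set G}, min_indep_dom A & x \in A].
Proof.
have EG := idom_card cardG G2c Gt; split=> //.
- move=> A /andP[iA /eqP cA] [u [v [uA vA uv]]].
  have := admissible_indep_dom_card cardG G2c Gt iA uA vA uv.
  by rewrite cA EG; clear; lia.
- by move=> x; rewrite EG; apply: idom_del_vertex.
- move=> x; have [A [iA cA xA]] := indep_dom_through cardG G2c Gt x.
  by exists A => //; rewrite /min_indep_dom iA cA EG /=.
Qed.
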